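(* Let $q$ be a power of $2$ and let $n=q^2+q+1$. Then $$q^3+2q-3\le \psi'(K_n).$$
   Context: $K_n$ is the complete graph on $n$ vertices and $[k]=\{1,\dots,k\}$. For a finite simple graph $H$, a complete $k$-coloring of $H$ is a (not necessarily proper) map $\varsigma\colon V(H)\to[k]$ such that for each pair of different colors $i,j\in[k]$ there is an edge $xy\in E(H)$ with $x\in\varsigma^{-1}(i)$ and $y\in\varsigma^{-1}(j)$. The pseudoachromatic number $\psi(H)$ is the largest $k$ for which $H$ has a complete $k$-coloring. The pseudoachromatic index of a graph $G$ is $\psi'(G)=\psi(L(G))$, where $L(G)$ is the line graph of $G$. Equivalently, $\psi'(K_n)$ is the largest $k$ for which the edges of $K_n$ can be colored (not necessarily properly) with $k$ colors so that for every two different colors there is a vertex incident with edges of both colors. *)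

(* Defs.v *)
From mathcomp Require Import all_boot.

Set Implicit Arguments.
Unset Strict Implicit.
Unset Printing Implicit Defensive.

Record sgraph := SGraph {
  vertex :> finType;
  adj : rel vertex;
  adj_sym : symmetric adj;
  adj_irrefl : irreflexive adj }.

Definition edges (G : sgraph) : {set {set G}} :=
  [set e : {set G} |
    [exists x : G, exists y : G, adj x y && (e == [set x; y])]].

Section LineGraph.
Variable G : sgraph.

Definition line_adj : rel {e : {set G} | e \in edges G} :=
  fun e f => (e != f) && (val e :&: val f != set0).

Lemma line_adj_sym : symmetric line_adj.
Proof. by move=> e f; rewrite /line_adj eq_sym setIC. Qed.

Lemma line_adj_irrefl : irreflexive line_adj.
Proof. by move=> e; rewrite /line_adj eqxx. Qed.

Definition line_graph : sgraph := SGraph line_adj_sym line_adj_irrefl.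

End LineGraph.

Section CompleteGraph.
Variable n : nat.

Definition complete_adj : rel 'I_n := fun x y => x != y.

Lemma complete_adj_sym : symmetric complete_adj.
Proof. by move=> x y; rewrite /complete_adj eq_sym. Qed.

Lemma complete_adj_irrefl : irreflexive complete_adj.
Proof. by move=> x; rewrite /complete_adj eqxx. Qed.

Definition complete_graph : sgraph :=
  SGraph complete_adj_sym complete_adj_irrefl.

End CompleteGraph.

Definition complete_coloring (H : sgraph) (k : nat) (c : H -> 'I_k) : bool :=
  [forall i : 'I_k, forall j : 'I_k, (i != j) ==>
    [exists x : H, exists y : H, [&& adj x y, c x == i & c y == j]]].

Definition complete_colorable (H : sgraph) (k : nat) : bool :=
  [exists c : {ffun H -> 'I_k}, complete_coloring c].

(* The bound on k excludes nothing (see complete_colorable_bound): for k >= 2  *)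
(* every color is used, so k <= #|H|, and k = 1 is always possible, even when  *)
(* H has no vertex.                                                            *)
Definition pseudoachromatic (H : sgraph) : nat :=
  \max_(k < #|H|.+2 | complete_colorable H k) k.

Definition pseudoachromatic_index (G : sgraph) : nat :=
  pseudoachromatic (line_graph G).

Lemma complete_colorable1 (H : sgraph) : complete_colorable H 1.
Proof.
apply/existsP; exists [ffun=> ord0]; apply/forallP => i; apply/forallP => j.
by rewrite (ord1 i) (ord1 j) eqxx.
Qed.

Lemma complete_colorable_bound (H : sgraph) (k : nat) :
  complete_colorable H k -> k < #|H|.+2.
Proof.
case: k => [|[|k]] // /existsP[c /forallP cc].
suff: #|'I_k.+2| <= #|H| by rewrite card_ord; apply: leqW.
have surj i : exists x, c x = i.
  pose j : 'I_k.+2 := if i == ord0 then ord_max else ord0.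
  have ij : i != j by rewrite /j; case: (eqVneq i ord0) => [->|].
  have /forallP/(_ j)/implyP/(_ ij)/existsP[x /existsP[y]] := cc i.
  by case/and3P=> _ /eqP <- _; exists x.
apply: leq_trans (leq_image_card c H).
apply/subset_leq_card/subsetP=> i _.
by case: (surj i) => x <-; apply: image_f.
Qed.

Lemma pseudoachromaticP (H : sgraph) :
  complete_colorable H (pseudoachromatic H) /\
  forall k, complete_colorable H k -> k <= pseudoachromatic H.
Proof.
split=> [|k ck].
  rewrite /pseudoachromatic.
  have [|i ci Ei] := @eq_bigmax_cond _ [pred k : 'I_#|H|.+2 |
    complete_colorable H k] (@nat_of_ord _).
    by apply/card_gt0P; exists (@Ordinal #|H|.+2 1 isT); exact: complete_colorable1.
  by rewrite Ei.
exact: (@leq_bigmax_cond _ _ (@nat_of_ord _)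
  (Ordinal (complete_colorable_bound ck)) ck).
Qed.

(* Main.v *)
Require Import Defs.
From mathcomp Require Import all_boot all_algebra all_field zify ring.

Set Implicit Arguments.
Unset Strict Implicit.
Unset Printing Implicit Defensive.

(** View the vertices of K_n as the points of the projective plane over a field
    F with q elements; the edges of K_n are then split into the complete graphs
    K_(q+1) on the lines.  If each color is attached to a line and touches every
    point of that line, then any two colors meet, at a common point of their
    lines ([lines_meet]) or anywhere on the line they share.  So the question is
    how many colors can be attached to the lines.

    A color touching all q+1 points of a line, an odd number, needs (q+2)/2
    edges, while the line has q(q+1)/2 = (q-1)(q+2)/2 + 1 edges.  Hence a line
    can have q-1 colors of its own with one surplus edge left over
    ([poor_cover]).  A line can have q colors if it receives q/2 edges from
    outside: split K_(q+1) into q near-perfect matchings, the classes of i+j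
    modulo q+1 for nonzero sums, and complete half of them by the edges of the
    class of sum 0; each of the other q/2 misses exactly one point
    ([cyc_color_cover]), which a surplus edge of a line through that point can
    cover ([rich_cover]).

    Take as rich lines the 2(q-1) affine lines x = c and y = c with c <> 0.  The
    q(q-1) lines y = s x + t with s <> 0 pass their surplus edges on: for each s,
    half of the values of t serve the line x = s and the other half the line
    y = s, and for fixed s different t meet such a line in different points, so
    each rich line gets its q/2 edges at distinct points, which can be taken as
    the points it misses.  The total is (q^2+q+1)(q-1) + 2(q-1) = q^3+2q-3
    colors ([card_palette]). *)

(** * From covering colors to the pseudoachromatic index *)

(** Colors outside [D] may be used by [col]; they are merged into a color of
    [D], which cannot spoil completeness. *)
Lemma pseudoachromatic_index_complete_ge (V C : finType) (D : {set C})
    (col : {set V} -> C) :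
  (forall c d, c \in D -> d \in D -> c != d ->
     exists x y z, [/\ y != x, z != x, col [set x; y] = c & col [set x; z] = d]) ->
  #|D| <= pseudoachromatic_index (complete_graph #|V|).
Proof.
move=> colP; case: (set_0Vmem D) => [->|[c0 Dc0]]; first by rewrite cards0.
apply: (pseudoachromaticP _).2; apply/existsP.
pose points (e : {set 'I_#|V|}) : {set V} := [set enum_val v | v in e].
exists [ffun e : line_graph (complete_graph #|V|) =>
         enum_rank_in Dc0 (col (points (val e)))].
apply/forallP=> i; apply/forallP=> j; apply/implyP=> ij.
have ij' : enum_val i != enum_val j by apply: contra ij => /eqP/enum_val_inj->.
have [x [y [z [yx zx ci cj]]]] := colP _ _ (enum_valP i) (enum_valP j) ij'.
have edgeP u : u != x ->
    [set enum_rank x; enum_rank u] \in edges (complete_graph #|V|).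
  move=> ux; rewrite inE; apply/existsP; exists (enum_rank x).
  apply/existsP; exists (enum_rank u); rewrite eqxx andbT /= /complete_adj.
  by apply: contra ux => /eqP/enum_rank_inj->.
have pointsP u : points [set enum_rank x; enum_rank u] = [set x; u].
  by rewrite /points imsetU !imset_set1 !enum_rankK.
apply/existsP; exists (exist (fun e => e \in edges _) _ (edgeP _ yx)).
apply/existsP; exists (exist (fun e => e \in edges _) _ (edgeP _ zx)).
rewrite !ffunE /= /line_adj /= !pointsP ci cj !enum_valK_in !eqxx !andbT.
apply/andP; split; last by apply/set0Pn; exists (enum_rank x); rewrite !inE eqxx.
apply: contra ij' => /eqP/(congr1 val) /= /(congr1 points).
by rewrite !pointsP -ci -cj => ->.
Qed.

(** * Coloring the edges of a line *)

(** The classes of i+j modulo q+1 on {0, ..., q}, except that the class of sum 0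
    is broken up: its edge {h, q+1-h} with h <= q/2 joins the class of 2h, the
    class that misses h. *)
Definition cyc_color q i j :=
  if i + j <= q then i + j
  else if i + j == q.+1 then 2 * minn i j else i + j - q.+1.

Lemma cyc_colorC q i j : cyc_color q i j = cyc_color q j i.
Proof. by rewrite /cyc_color addnC minnC. Qed.

(** Class k misses only the solution of 2i = k modulo q+1.  For even k it is k/2,
    covered by the edge taken from the class of sum 0; for odd k it is
    (k+q+1)/2, which stays uncovered. *)
Lemma cyc_color_cover q k i : ~~ odd q -> 0 < k <= q -> i <= q ->
  (exists j, [/\ j <= q, j != i & cyc_color q i j = k]) \/ 2 * i = k + q.+1.
Proof.
move=> qE k_q i_q; rewrite /cyc_color.
have [ki|ki] := eqVneq (2 * i) k.
  by left; exists (q.+1 - i); split; do ?case: ifP => ?; lia.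
have [kqi|kqi] := eqVneq (2 * i) (k + q.+1); first by right.
left; have [le_ik|lt_ki] := leqP i k.
  by exists (k - i); split; do ?case: ifP => ?; lia.
by exists (k + q.+1 - i); split; do ?case: ifP => ?; lia.
Qed.

(** * The projective plane *)

Section Plane.

Variables (F : finFieldType) (q : nat).
Hypothesis cardF : #|F| = q.
Hypothesis charF2 : 2 \in [pchar F]%R.
Hypothesis evenF : ~~ odd q.

(** [inl (x, y)] is affine, [inr (Some s)] is the point at infinity of the lines
    of slope s, and [inr None] that of the vertical lines. *)
Definition point := (F * F + option F)%type.
(** [inl (s, t)] is y = s x + t, [inr (Some c)] is x = c, and [inr None] is the
    line at infinity. *)
Definition line := (F * F + option F)%type.

Local Open Scope ring_scope.
Import GRing.Theory.

(** Every line is parametrized by F and an extra element, so that incidence and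
    colorings of a line can be stated in terms of parameters. *)
Definition pt (l : line) (a : option F) : point :=
  match l, a with
  | inl (s, t), Some x => inl (x, s * x + t)
  | inl (s, _), None => inr (Some s)
  | inr (Some c), Some y => inl (c, y)
  | inr None, Some s => inr (Some s)
  | inr _, None => inr None
  end.

Lemma pt_inj l : injective (pt l).
Proof. by case: l => [[s t]|[c|]] [x|] [y|] //= []; congruence. Qed.

Lemma lines_meet l m : exists a b, pt l a = pt m b.
Proof.
case: l m => [[s t]|[c|]] [[s' t']|[c'|]].
- have [->|ss] := eqVneq s s'; first by exists None, None.
  exists (Some ((t' - t) / (s - s'))), (Some ((t' - t) / (s - s'))) => /=.
  by congr (inl (_, _)); field; rewrite subr_eq0.
- by exists (Some c'), (Some (s * c' + t)).
- by exists None, (Some s).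
- by exists (Some (s' * c + t')), (Some c).
- by exists None, None.
- by exists None, None.
- by exists (Some s'), None.
- by exists None, None.
- by exists None, None.
Qed.

Lemma two_points_line l m a a' b b' : a <> a' ->
  pt l a = pt m b -> pt l a' = pt m b' -> l = m.
Proof.
case: l m => [[s t]|[c|]] [[s' t']|[c'|]];
  case: a => [x|]; case: a' => [x'|]; case: b => [y|]; case: b' => [y'|] //=;
  try congruence.
- move=> ne [<- e1] [<- e2]; have ss : s = s'.
    apply/eqP; rewrite -subr_eq0; apply: contra_notT ne => ss; congr Some.
    apply/eqP; rewrite -subr_eq0 -(mulrI_eq0 _ (mulfI ss)).
    have -> : (s - s') * (x - x') = (s * x + t) - (s' * x + t')
       - ((s * x' + t) - (s' * x' + t')) by ring.
    by rewrite e1 e2 !subrr.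
  by move: e1; rewrite ss => /addrI->.
- by move=> _ [<- e] [ss]; move: e; rewrite ss => /addrI->.
- by move=> _ [<-] [<- /addrI->].
Qed.

(** * The colors *)

(** An arbitrary numbering of F by 1, ..., q, leaving 0 for the point at infinity
    of a line. *)
Definition num (x : F) : nat := (enum_rank x).+1.

Lemma num_bounds x : (0 < num x <= q)%N.
Proof. by rewrite -cardF; exact: ltn_ord. Qed.

Lemma num_inj : injective num.
Proof. by move=> x y [] /ord_inj/enum_rank_inj. Qed.

Lemma num_surj k : (0 < k <= q)%N -> exists x, num x = k.
Proof.
rewrite -cardF; case: k => // k kq.
by exists (enum_val (Ordinal kq)); rewrite /num enum_valK.
Qed.

Definition rich (l : line) :=
  match l with
  | inl (s, t) => (s == 0) && (t != 0)
  | inr (Some c) => c != 0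
  | inr None => false
  end.

(** The numbering of the points of a rich line used by [cyc_color].  It is chosen
    so that the points missed by an odd color, those with label above q/2, are
    where the lines donating to it meet it.  The line of slope s and intercept t
    meets x = s at y = s * s + t, with label [num t], and y = s at the x with
    s - s * x = t, with label [q.+1 - num t]; exactly one of the two labels
    exceeds q/2. *)
Definition label (l : line) (a : option F) : nat :=
  match l, a with
  | inr (Some c), Some y => num (y - c * c)
  | inl (_, d), Some x => q.+1 - num (d - d * x)
  | _, _ => 0
  end.

(** The surplus edge of a poor line joins its point at infinity to the affine
    point of abscissa [apex l], where it meets the rich line it donates to.  The
    poor lines that do not donate have 0 as a default. *)
Definition apex (l : line) : F :=
  if l is inl (s, t) then
    if s == 0 then 0 else if (q < 2 * num t)%N then s else (s - t) / s
  else 0.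

Definition color := (line * 'I_q.+1)%type.

(** The color given to the surplus edge of a poor line: label h of a rich line is
    missed by the color 2h - (q+1).  For the poor lines that do not donate, the
    value is a default. *)
Definition heir (l : line) : color :=
  if l is inl (s, t) then
    if (q < 2 * num t)%N then (inr (Some s), inord (2 * num t - q.+1))
    else (inl (0, s), inord (q.+1 - 2 * num t))
  else (l, ord0).

(** In characteristic 2 each nonzero sum x + y = c is a perfect matching of F.
    Color c also takes one of the q edges at the parameter at infinity, and the
    edge from infinity to [z] is the only one of color 0: it is the surplus. *)
Definition poor_color (z : F) (a b : option F) : F :=
  match a, b with
  | Some x, Some y => x + y
  | Some x, None | None, Some x => x - z
  | None, None => 0
  end.

Definition local_color (l : line) (a b : option F) : 'I_q.+1 :=
  inord (if rich l then cyc_color q (label l a) (label l b)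
         else num (poor_color (apex l) a b)).

Definition edge_color (l : line) (a b : option F) : color :=
  let k := local_color l a b in
  if ~~ rich l && (k == num 0 :> nat) then heir l else (l, k).

Lemma edge_colorC l a b : edge_color l a b = edge_color l b a.
Proof.
rewrite /edge_color /local_color cyc_colorC.
by case: a b => [x|] [y|] //=; rewrite addrC.
Qed.

Definition coloring (e : {set point}) : color :=
  if [pick z : line * option F * option F |
        (z.1.2 != z.2) && (e == [set pt z.1.1 z.1.2; pt z.1.1 z.2])] is Some z
  then edge_color z.1.1 z.1.2 z.2 else (inr None, ord0).

(** Two distinct points lie on one line only, and [edge_color] is symmetric, so
    the choice made in [coloring] does not matter. *)
Lemma coloring_line l a b : a <> b ->
  coloring [set pt l a; pt l b] = edge_color l a b.
Proof.
move=> ab; rewrite /coloring; case: pickP => [[[m c] d] /= /andP[/eqP cd /eqP e]|].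
  have /set2P Pa : pt l a \in [set pt m c; pt m d] by rewrite -e set21.
  have /set2P Pb : pt l b \in [set pt m c; pt m d] by rewrite -e set22.
  have ablm : l = m.
    by case: Pa Pb => pa [] pb; apply: (two_points_line ab pa pb).
  move: Pa Pb; rewrite -ablm => -[] /pt_inj ea [] /pt_inj eb; subst => //.
  by rewrite edge_colorC.
by move=> /(_ (l, a, b)) /=; rewrite eqxx andbT => /negbFE/eqP.
Qed.

(** Rich lines have the colors 1, ..., q; poor lines lack the color of their
    surplus edge. *)
Definition palette : {set color} :=
  [set c : color | (c.2 != ord0) && (rich c.1 || (c.2 != num 0 :> nat))].

Lemma label_inj l : rich l -> injective (label l).
Proof.
case: l => [[s d]|[c|]] //= => [/andP[/eqP-> d0]|c0] [x|] [y|] //=.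
- move=> e; have /num_inj/addrI/oppr_inj/(mulfI d0)-> // :
    num (d - d * x) = num (d - d * y).
  by have := num_bounds (d - d * x); have := num_bounds (d - d * y); lia.
- by have := num_bounds (d - d * x); lia.
- by have := num_bounds (d - d * y); lia.
- by move=> /num_inj/addIr->.
Qed.

Lemma label_surj l k : rich l -> (k <= q)%N -> exists a, label l a = k.
Proof.
move=> lR; have [->|k0 kq] := posnP k.
  by exists None; case: l lR => [[]|[]].
case: l lR => [[s d]|[c|]] //= => [/andP[_ d0]|c0].
  have [|u uk] := @num_surj (q.+1 - k); first lia.
  exists (Some ((d - u) / d)).
  have -> : d - d * ((d - u) / d) = u by field.
  by rewrite uk; lia.
have [|u uk] := @num_surj k; first lia.
by exists (Some (u + c * c)); rewrite addrK.
Qed.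

Lemma label_le l a : (label l a <= q)%N.
Proof.
case: l a => [[s d]|[c|]] [x|] //=; last exact: (andP (num_bounds _)).2.
by have := num_bounds (d - d * x); lia.
Qed.

(** * Every color covers its line *)

Lemma surplus_color l : ~~ rich l ->
  coloring [set pt l None; pt l (Some (apex l))] = heir l.
Proof.
move=> lP; rewrite coloring_line // /edge_color lP /local_color (negbTE lP) /=.
rewrite subrr inordK ?eqxx // ltnS; exact: (andP (num_bounds _)).2.
Qed.

(** The partner of x in color c is c - x, which differs from x because c is
    nonzero and x + x = 0. *)
Lemma poor_cover l k a : ~~ rich l -> (l, k) \in palette ->
  exists2 b, b <> a & coloring [set pt l a; pt l b] = (l, k).
Proof.
move=> lP; rewrite inE /= (negbTE lP) => /andP[k0 k1].
have [|c ck] := @num_surj k; first by rewrite lt0n k0 -ltnS ltn_ord.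
have c0 : c != 0 by apply: contra k1 => /eqP <-; rewrite ck.
suff [b ba bc] : exists2 b, b <> a & poor_color (apex l) a b = c.
  exists b => //; rewrite coloring_line; last by move=> ab; apply: ba.
  rewrite /edge_color /local_color lP (negbTE lP) bc ck inord_val.
  by rewrite (negbTE k1).
case: a => [x|]; last by exists (Some (c + apex l)); rewrite //= addrK.
exists (Some (c - x)); last by rewrite /= addrC subrK.
move=> [] e; move/eqP: c0; apply.
by rewrite -(subrK x c) e (addrr_pchar2 charF2).
Qed.

Lemma rich_cover l k a : rich l -> (l, k) \in palette ->
  exists2 p, p <> pt l a & coloring [set pt l a; p] = (l, k).
Proof.
move=> lR; rewrite inE /= lR orTb andbT => k0.
have kq : (0 < k <= q)%N by rewrite lt0n k0 -ltnS ltn_ord.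
have [[j [jq ja cjk]]|ak] := cyc_color_cover evenF kq (label_le l a).
  have [b bj] := label_surj lR jq.
  have ba : b <> a by move=> ba; rewrite -bj ba eqxx in ja.
  exists (pt l b); first by move=> /pt_inj.
  rewrite coloring_line; last by move=> ab; apply: ba.
  by rewrite /edge_color /local_color lR /= bj cjk inord_val.
(* The color misses this point: use the surplus edge of a poor line m whose
   apex is this point. *)
suff [m [mP mh mp]] : exists m,
    [/\ ~~ rich m, heir m = (l, k) & pt m (Some (apex m)) = pt l a].
  exists (pt m None); first by rewrite -mp => /pt_inj.
  by rewrite -mp setUC surplus_color.
case: l lR a ak => [[s d]|[c|]] //= => [/andP[/eqP-> d0]|c0] [x|] /=; try lia.
  (* On y = d, the donor through the point is y = d x + u. *)
  set u := d - d * x => uk; have := num_bounds u => ub.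
  have uF : (q < 2 * num u)%N = false by lia.
  exists (inl (d, u)); rewrite /= (negbTE d0) uF; split=> //.
    by congr (_, _); apply: val_inj; rewrite /= inordK; lia.
  have -> : (d - u) / d = x by rewrite /u; field.
  by congr (inl (_, _)); rewrite /u; ring.
(* On x = c, the donor through the point of ordinate x is y = c x + u. *)
set u := x - c * c => uk; have := num_bounds u => ub.
have uT : (q < 2 * num u)%N by lia.
exists (inl (c, u)); rewrite /= (negbTE c0) uT; split=> //.
  by congr (_, _); apply: val_inj; rewrite /= inordK; lia.
by congr (inl (_, _)); rewrite /u; ring.
Qed.

Lemma palette_cover l k a : (l, k) \in palette ->
  exists2 p, p != pt l a & coloring [set pt l a; p] = (l, k).
Proof.
have [lR|lP] := boolP (rich l) => lk.
  by have [p /eqP] := rich_cover a lR lk; exists p.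
have [b ba bc] := poor_cover a lP lk; exists (pt l b) => //.
by apply/eqP => /pt_inj.
Qed.

(** * Counting the colors *)

Lemma card_rich : (2 * q.-1 <= #|[set l | rich l]|)%N.
Proof.
pose horizontal (d : F) : line := inl (0, d).
pose vertical (c : F) : line := inr (Some c).
have card_img (f : F -> line) : injective f -> #|f @: [set~ 0]| = q.-1.
  by move=> f_inj; rewrite card_imset // cardsC1 cardF.
have disj : [disjoint horizontal @: [set~ 0] & vertical @: [set~ 0]].
  apply/pred0P=> l /=; apply/negP=> /andP[/imsetP[d _ ->]].
  by case/imsetP.
rewrite mul2n -addnn -{1}(card_img horizontal); last by move=> ? ? [].
rewrite -(card_img vertical); last by move=> ? ? [].
move: disj; rewrite -(leq_card_setU _ _).2 => /eqP <-.
apply/subset_leq_card/subsetP=> l; rewrite !inE.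
by case/orP=> /imsetP[c]; rewrite !inE => c0 -> /=; rewrite ?eqxx.
Qed.

Lemma card_palette : (q ^ 3 + 2 * q - 3 <= #|palette|)%N.
Proof.
have [k1 k1E] : exists k : 'I_q.+1, k = num 0 :> nat.
  by exists (inord (num 0)); rewrite inordK // ltnS; case/andP: (num_bounds 0).
have k1_0 : k1 != ord0.
  by rewrite -val_eqE /= k1E.
(* q-1 colors on every line, and one more on each rich line *)
pose A : {set color} := setX [set: line] (~: [set ord0; k1]).
pose B : {set color} := setX [set l | rich l] [set k1].
have AB : [disjoint A & B].
  apply/pred0P=> -[l k] /=; rewrite !inE /=.
  by case: (k == k1); rewrite ?orbT ?andbF.
have -> : palette = A :|: B.
  apply/setP=> -[l k]; rewrite !inE /= -k1E val_eqE.
  have [->|_] := eqVneq k k1; first by rewrite k1_0 orbT !andbT orbF.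
  by rewrite orbT orbF !andbT andbF orbF.
move: AB; rewrite -(leq_card_setU _ _).2 => /eqP ->.
rewrite !cardsX cards1 cardsT.
rewrite card_sum card_prod card_option cardF muln1.
have s_eq : #|~: [set ord0; k1]| = q.-1.
  by have := cardsC [set ord0; k1]; rewrite cards2 eq_sym k1_0 card_ord; lia.
have q0 : (0 < q)%N by rewrite -cardF; apply/card_gt0P; exists 0.
apply: leq_trans (leq_add (leqnn _) card_rich); rewrite s_eq -(prednK q0) /=.
rewrite leq_subLR; apply/eq_leq; ring.
Qed.

Lemma card_point : #|{: point}| = (q ^ 2 + q + 1)%N.
Proof. by rewrite card_sum card_prod card_option cardF; lia. Qed.

Lemma pseudoachromatic_index_plane :
  (q ^ 3 + 2 * q - 3 <=
     pseudoachromatic_index (complete_graph (q ^ 2 + q + 1)))%N.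
Proof.
rewrite -card_point; apply: leq_trans card_palette _.
apply: (pseudoachromatic_index_complete_ge (col := coloring)).
move=> [l k] [m h] lk mh _; have [a [b ab]] := lines_meet l m.
have [y ya cy] := palette_cover a lk; have [z zb cz] := palette_cover b mh.
by exists (pt l a), y, z; split=> //; rewrite ab.
Qed.

End Plane.

Theorem theorem5 (q n : nat) (hq : exists m : nat, q = 2 ^ m)
    (hn : n = q ^ 2 + q + 1) :
  q ^ 3 + 2 * q - 3 <= pseudoachromatic_index (complete_graph n).
Proof.
(* For q = 1 there is no field, but the bound is 0. *)
case: hq hn => -[|m] -> -> //.
have [F charF cardF] := pPrimePowerField (isT : prime 2) (ltn0Sn m).
by apply: (pseudoachromatic_index_plane cardF charF); rewrite expnS oddM.
Qed.
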